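(* Let $G=(V,E)$ be a finite simple graph and $k$ a positive integer. Suppose that every vertex has degree at most $k$ and that the set of vertices of degree exactly $k$ spans no cycle in $G$ (i.e. the subgraph induced by the vertices of degree $k$ is a forest). Then there is a proper edge colouring $\phi:E\to\{1,\dots,k\}$ which is local, i.e. for every edge $e=xy$, $$\phi(e)\le \max\{d(x)+\pi(x),\; d(y)+\pi(y)\},$$ where $d(z)$ is the degree of $z$ and $\pi(z)$ is the maximum multiplicity of an edge at $z$ (so $\pi(z)=1$ for every non-isolated vertex $z$ of a simple graph).
   Context: An edge colouring is proper if no two distinct edges sharing an end-point receive the same colour. *)

(* Defs.v *)
From mathcomp Require Import all_boot.

Set Implicit Arguments.
Unset Strict Implicit.
Unset Printing Implicit Defensive.

(* A finite simple graph is a symmetric irreflexive adjacency relation on a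
   finType; its edges are the two-element sets of adjacent vertices. *)
Definition simple_graph (T : finType) (e : rel T) : Prop :=
  symmetric e /\ irreflexive e.

Definition edges (T : finType) (e : rel T) : {set {set T}} :=
  [set [set x; y] | x in T, y in T & e x y].

Definition degree (T : finType) (e : rel T) (x : T) : nat :=
  #|[set E in edges e | x \in E]|.

Definition multiplicity (T : finType) (e : rel T) (x y : T) : nat :=
  #|[set E in edges e | E == [set x; y]]|.

Definition max_multiplicity (T : finType) (e : rel T) (x : T) : nat :=
  \max_(y | e x y) multiplicity e x y.

(* The bound 2 < size c is needed because ucycle also accepts the empty
   sequence and the closed walk x, y, x along a single edge. *)
Definition graph_cycle (T : finType) (e : rel T) (c : seq T) : Prop :=
  2 < size c /\ ucycle e c.

Definition spans_no_cycle (T : finType) (e : rel T) (S : {set T}) : Prop :=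
  forall c : seq T, {subset c <= S} -> ~ graph_cycle e c.

(* Only the values of a colouring on edges e are relevant. *)
Definition edge_colouring (T : finType) (e : rel T) (k : nat)
    (phi : {set T} -> nat) : Prop :=
  forall E, E \in edges e -> 1 <= phi E <= k.

Definition proper_colouring (T : finType) (e : rel T)
    (phi : {set T} -> nat) : Prop :=
  forall E F, E \in edges e -> F \in edges e ->
    E != F -> E :&: F != set0 -> phi E != phi F.

Definition local_colouring (T : finType) (e : rel T)
    (phi : {set T} -> nat) : Prop :=
  forall x y, e x y ->
    phi [set x; y] <= maxn (degree e x + max_multiplicity e x)
                           (degree e y + max_multiplicity e y).

(* Main.v *)
(* Among the partial local proper colourings with colours 1..k, take one that
   minimises the sum over the vertices of (essentially) the smallest missing
   colour, where each uncoloured edge carries an additional cost at its two ends.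
   Suppose that zw is uncoloured.  Along a Vizing fan at z in which every vertex
   offers its smallest missing colour, shifting the uncoloured edge keeps the
   potential minimal.  The same holds along alternating paths, and minimality
   also shows that the colour given up by the next vertex is at most its degree
   plus one; hence recolouring never violates locality.  Vizing's argument then
   excludes a repeated colour in the fan, which must therefore end at a vertex
   y <> w that sees all k colours, and the uncoloured edge can be moved to zy.
   Starting again with the hub y, and so on, gives a non-backtracking walk among
   the vertices of degree k, which is impossible in a forest. *)

Require Import Defs.
From mathcomp Require Import all_boot.
From mathcomp Require Import zify.
From Stdlib Require Import Classical.

Set Implicit Arguments.
Unset Strict Implicit.
Unset Printing Implicit Defensive.

(** * Partial colourings and the potential *)

Section LocalColouring.

Variables (T : finType) (e : rel T) (k : nat).
Hypotheses (e_sym : symmetric e) (e_irr : irreflexive e).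
Hypothesis (e_deg : forall x, #|e x| <= k).

Implicit Types (f g : T -> T -> nat) (x y z u v w p q r : T) (S X Y : {set T}).

(* The colour 0 stands for uncoloured. *)
Definition partial_colouring f : Prop :=
  [/\ forall x y, f x y = f y x,
      forall x y, f x y != 0 -> e x y,
      forall x y, f x y <= k,
      forall x y z, f x y != 0 -> f x y = f x z -> y = z
    & forall x y, f x y <= (maxn #|e x| #|e y|).+1].

Definition recolour f x y b u v :=
  if ((u == x) && (v == y)) || ((u == y) && (v == x)) then b else f u v.

Definition misses f x b := [/\ 0 < b, b <= k & forall y, f x y != b].

(* Uncoloured edges are counted for every threshold c. *)
Definition low_degree f x c := \sum_(y | e x y) (f x y <= c).

(** Weaker than [b] being the smallest missing colour, since uncoloured edges count too; this form
    survives a shift. *)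
Definition tight f x b := forall c, c < b -> c <= low_degree f x c.

(* If all the edges at x are coloured, this is the smallest missing colour at x,
   capped at k. *)
Definition vpotential f x := \sum_(c < k) ((low_degree f x c).+1 - c).

Definition potential f := \sum_x vpotential f x.

Definition minimal f :=
  partial_colouring f /\
  forall g, partial_colouring g -> potential f <= potential g.

(** * Changing the colour of one edge *)

Lemma recolourC f x y b : recolour f x y b =2 recolour f y x b.
Proof. by move=> u v; rewrite /recolour orbC. Qed.

Lemma recolour_row f x y b v : x != y ->
  recolour f x y b x v = if v == y then b else f x v.
Proof. by move=> /negPf xy; rewrite /recolour eqxx xy /= orbF. Qed.

Lemma recolour_off f x y b u v : u != x -> u != y ->
  recolour f x y b u v = f u v.
Proof. by move=> /negPf ux /negPf uy; rewrite /recolour ux uy. Qed.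

Lemma edge_neq x y : e x y -> x != y.
Proof. by case: eqP => // ->; rewrite e_irr. Qed.

(** Uncolouring is the case [b = 0], where the last premise is vacuous. *)
Lemma recolour_partial f x y b : partial_colouring f -> e x y ->
    b <= k -> b <= (maxn #|e x| #|e y|).+1 ->
    (b != 0 -> misses f x b /\ misses f y b) ->
  partial_colouring (recolour f x y b).
Proof.
move=> [fC fe fk finj floc] exy bk bloc bmiss.
have xy := edge_neq exy; have yx : y != x by rewrite eq_sym.
have rowx v := recolour_row f b v xy.
have rowy v : recolour f x y b y v = if v == x then b else f y v.
  by rewrite recolourC recolour_row.
split.
- by move=> u v; rewrite /recolour fC [(u == x) && _]andbC [(u == y) && _]andbC
    orbC.
- move=> u v; rewrite /recolour.
  by case: ifP => [/orP[]/andP[/eqP-> /eqP->] _|_ /fe] //; rewrite e_sym.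
- by move=> u v; rewrite /recolour; case: ifP.
- move=> u v w.
  have key s t : (forall v, recolour f x y b s v = if v == t then b else f s v)
      -> (b != 0 -> misses f s b) ->
      recolour f x y b s v != 0 ->
      recolour f x y b s v = recolour f x y b s w -> v = w.
    move=> row sb; rewrite !row.
    have [->|_] := eqVneq v t; have [->|_] := eqVneq w t => //.
    + by move=> /sb[_ _ /(_ w)/eqP nb] eb; case: nb.
    + by move=> nz eb; move: nz; rewrite eb => /sb[_ _ /(_ v)]; rewrite eb eqxx.
    + by move=> nz; exact: finj.
  have [->|ux] := eqVneq u x; first by apply: key rowx _ => /bmiss[].
  have [->|uy] := eqVneq u y; first by apply: key rowy _ => /bmiss[].
  by rewrite !recolour_off //; exact: finj.
- move=> u v; rewrite /recolour.
  by case: ifP => [/orP[]/andP[/eqP-> /eqP->]|] //; rewrite maxnC.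
Qed.

Lemma low_degree_recolour f x y b c : e x y ->
  low_degree (recolour f x y b) x c + (f x y <= c) =
  low_degree f x c + (b <= c).
Proof.
move=> exy; have xy := edge_neq exy.
rewrite /low_degree (bigD1 y) //= [X in _ = X + _](bigD1 y exy) /=.
rewrite recolour_row // eqxx.
rewrite (eq_bigr (fun v => (f x v <= c) : nat)) => [|v /andP[_ /negPf vy]].
  by lia.
by rewrite recolour_row // vy.
Qed.

Lemma low_degreeC f x y b v c :
  low_degree (recolour f x y b) v c = low_degree (recolour f y x b) v c.
Proof. by apply: eq_bigr => u _; rewrite recolourC. Qed.

Lemma low_degree_off f x y b v c : v != x -> v != y ->
  low_degree (recolour f x y b) v c = low_degree f v c.
Proof. by move=> vx vy; apply: eq_bigr => u _; rewrite recolour_off. Qed.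

(** * Tightness and shifts of the uncoloured edge *)

Lemma low_degree_le f x c : low_degree f x c <= #|e x|.
Proof.
by rewrite -sum1_card; apply: leq_sum => y _; exact: leq_b1.
Qed.

(** The threshold just below [b] counts at least [b - 1] edges. Locality of the recolourings comes
    from here. *)
Lemma tight_local f x b : tight f x b -> b <= #|e x|.+1.
Proof.
case: b => [//|b] /(_ b (leqnn _)) bx.
exact: leq_trans bx (low_degree_le _ _ _).
Qed.

(** Spreads a colour over the thresholds, for comparison with [vpotential] term by term. *)
Lemma sum_ltn b : b <= k -> \sum_(c < k) (c < b) = b.
Proof.
move=> bk; rewrite -(big_mkord xpredT (fun c => (c < b) : nat)).
rewrite (@big_cat_nat _ _ _ b) //= -[RHS]addn0; congr (_ + _).
  rewrite (eq_big_nat _ _ (F2 := fun=> 1)); first by rewrite sum_nat_const_nat; lia.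
  by move=> i /andP[_ ->].
by rewrite big_nat big1 // => i /andP[bi _]; rewrite ltnNge bi.
Qed.

(* Colouring wz with b lowers the degrees of w below every threshold c < b
   (tightness makes the corresponding truncated differences positive);
   uncolouring zy raises those of y by at most one. *)
Lemma potential_shift f g w y b : w != y -> b <= k -> tight f w b ->
    (forall v c, v != w -> v != y -> low_degree g v c = low_degree f v c) ->
    (forall c, low_degree g w c + 1 = low_degree f w c + (b <= c)) ->
    (forall c, low_degree g y c + (b <= c) = low_degree f y c + 1) ->
  potential g <= potential f /\
  (potential f <= potential g -> tight g y b).
Proof.
move=> wy bk wb goff gw gy; have yw : y != w by rewrite eq_sym.
have gwf : vpotential g w + b = vpotential f w.
  rewrite -[X in _ + X = _](sum_ltn bk) -big_split; apply: eq_bigr => c _ /=.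
  by have := gw c; have := @wb c; have [] := ltnP c b => cb; lia.
have split_potential h : potential h =
    vpotential h w + vpotential h y +
    \sum_(v | (v != w) && (v != y)) vpotential h v.
  by rewrite /potential (bigD1 w) //= (bigD1 y) //= addnA.
rewrite !split_potential -gwf.
rewrite (eq_bigr (vpotential f)); last first.
  by move=> v /andP[vw vy]; apply: eq_bigr => c _; rewrite goff.
have gyf c : (low_degree g y c).+1 - c <=
    ((low_degree f y c).+1 - c) + (c < b).
  by have := gy c; lia.
have le_gy : vpotential g y <= vpotential f y + b.
  rewrite -[X in _ <= _ + X](sum_ltn bk) -big_split /=.
  by apply: leq_sum => c _; exact: gyf.
split=> [|le_fg c cb]; first by lia.
(* If tightness fails at [c], the truncated term of [g] there is 0, so [gyf] is strict and [g] has
   the smaller potential. *)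
rewrite leqNgt; apply/negP => lt_gc.
have ck : c < k by lia.
suff: vpotential g y < vpotential f y + b by lia.
rewrite -[X in _ < _ + X](sum_ltn bk) -big_split /= /vpotential.
rewrite (bigD1 (Ordinal ck)) //= [X in _ < X](bigD1 (Ordinal ck)) //=.
rewrite -addSn leq_add //; first by rewrite cb; lia.
by apply: leq_sum => i _; exact: gyf.
Qed.

(* If b were missing at z as well, colouring zw with b would lower the
   potential. *)
Lemma minimal_shift f z w b : minimal f -> e z w -> f z w = 0 ->
    misses f w b -> tight f w b ->
  exists y, let g := recolour (recolour f z y 0) z w b in
  [/\ f z y = b, y != w, minimal g, misses g y b & tight g y b] /\
  (forall c, low_degree g z c = low_degree f z c) /\
  (forall c, misses f z c -> misses g z c).
Proof.
move=> [pf minf] ezw fzw wb tb; have [fC fe fk finj floc] := pf.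
have [b0 bk nwb] := wb; have zw := edge_neq ezw.
have wz : w != z by rewrite eq_sym.
have loc_b : b <= (maxn #|e z| #|e w|).+1.
  by apply: leq_trans (tight_local tb) _; rewrite ltnS leq_maxr.
have ewz : e w z by rewrite e_sym.
have [/existsP[y /eqP fzy]|/existsPn noy] := boolP [exists y, f z y == b].
  exists y; cbv zeta; set h := recolour f z y 0.
  have ezy : e z y by apply: fe; rewrite fzy; lia.
  have zy := edge_neq ezy; have yz : y != z by rewrite eq_sym.
  have yw : y != w by apply/eqP => yw; move: fzy; rewrite yw fzw; lia.
  have wy : w != y by rewrite eq_sym.
  have ph : partial_colouring h by exact: recolour_partial.
  have hz v : h z v = if v == y then 0 else f z v by exact: recolour_row.
  have hw v : h w v = f w v by rewrite /h recolour_off.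
  have hzb : misses h z b.
    split=> // v; rewrite hz; have [_|vy] := eqVneq v y; first by rewrite eq_sym -lt0n.
    apply/eqP => fzv; case/eqP: vy; apply: (finj z); first by rewrite fzv -lt0n.
    by rewrite fzv fzy.
  have pg : partial_colouring (recolour h z w b).
    by apply: recolour_partial => // _; split=> //; split=> // v; rewrite hw.
  set g := recolour h z w b in pg *.
  have gz v : g z v = if v == w then b else if v == y then 0 else f z v.
    by rewrite /g recolour_row // hz.
  have gy v : g y v = if v == z then 0 else f y v.
    by rewrite /g recolour_off // /h recolourC recolour_row.
  (* At [z] the edges [zw] and [zy] merely exchange the colours 0 and [b]. *)
  have degz c : low_degree g z c = low_degree f z c.
    have := low_degree_recolour h b c ezw; have := low_degree_recolour f 0 c ezy.
    by rewrite hz (negPf wy) fzw fzy -/h -/g; lia.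
  have degw c : low_degree g w c + 1 = low_degree f w c + (b <= c).
    rewrite /g low_degreeC; have := low_degree_recolour h b c ewz.
    by rewrite hw (low_degree_off f 0 c wz wy) fC fzw; lia.
  have degy c : low_degree g y c + (b <= c) = low_degree f y c + 1.
    rewrite /g low_degree_off // /h low_degreeC.
    have eyz : e y z by rewrite e_sym.
    by have := low_degree_recolour f 0 c eyz; rewrite fC fzy; lia.
  have degv v c : v != w -> v != y -> low_degree g v c = low_degree f v c.
    have [->|vz] := eqVneq v z; first by rewrite degz.
    by move=> vw vy; rewrite /g /h !low_degree_off.
  have [le_gf tight_g] := potential_shift wy bk tb degv degw degy.
  have min_g : minimal g.
    by split=> // f' pf'; exact: leq_trans le_gf (minf _ pf').
  split; [split=> //|split=> //].
  - split=> // v; rewrite gy; have [_|vz] := eqVneq v z; first by rewrite eq_sym -lt0n.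
    apply/eqP => fyv; case/eqP: vz; apply: (finj y); first by rewrite fyv -lt0n.
    by rewrite fyv fC fzy.
  - exact: tight_g (minf _ pg).
  - move=> c [c0 ck zc]; split=> // v; rewrite gz.
    have [_|_] := eqVneq v w; first by rewrite -fzy.
    by have [_|_] := eqVneq v y; rewrite // eq_sym -lt0n.
have zb : misses f z b by split.
have pg : partial_colouring (recolour f z w b) by exact: recolour_partial.
exfalso; suff: potential (recolour f z w b) < potential f.
  by rewrite ltnNge (minf _ pg).
have k0 : 0 < k by lia.
have degw c : low_degree (recolour f z w b) w c + 1 = low_degree f w c + (b <= c).
  rewrite low_degreeC; have := low_degree_recolour f b c ewz.
  by rewrite fC fzw.
have deg_le v c : low_degree (recolour f z w b) v c <= low_degree f v c.
  have [->|vw] := eqVneq v w; first by have := degw c; lia.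
  have [->|vz] := eqVneq v z; last by rewrite low_degree_off.
  by have := low_degree_recolour f b c ezw; rewrite fzw; lia.
(* The strict drop is at [w] and threshold 0, where only uncoloured edges count. *)
rewrite /potential (bigD1 w) //= [X in _ < X](bigD1 w) //= -addSn leq_add //.
  rewrite /vpotential (bigD1 (Ordinal k0)) //= [X in _ < X](bigD1 (Ordinal k0)) //=.
  rewrite -addSn leq_add //; first by have := degw 0; lia.
  by apply: leq_sum => c _; have := deg_le w c; lia.
by apply: leq_sum => v _; apply: leq_sum => c _; have := deg_le v c; lia.
Qed.

(** * Alternating paths *)

(* The uncoloured edge pq is pushed along the a/b-alternating path that leaves
   q; minimality keeps the path from stopping before it reaches r. *)
Lemma alternating_path f p q r a b X : minimal f -> e p q -> f p q = 0 ->
    misses f p a -> tight f p a -> misses f q b -> tight f q b ->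
    q \in X -> p \notin X -> r \notin X -> a != b ->
    (forall v u, v \in X -> f v u = a \/ f v u = b -> u \in X \/ u = r) ->
  exists Y, [/\ Y \subset X, q \in Y,
    forall v u, v \in Y -> f v u = a \/ f v u = b -> u \in Y \/ u = r,
    forall v, v \in Y -> v != q ->
      (exists u, f v u = a) /\ (exists u, f v u = b)
    & exists2 v, v \in Y & f v r = a \/ f v r = b].
Proof.
have [n] := ubnP #|X|; elim: n => // n IH in f p q a b X *.
move=> ltXn mf epq fpq pa ta qb tb qX pX rX ab closedX.
have [[fC fe _ finj _] _] := mf.
have eqp : e q p by rewrite e_sym.
have fqp : f q p = 0 by rewrite fC.
have [a0 _ _] := pa; have [b0 _ nqb] := qb.
(* With hub [q], the shift colours [qp] with [a] and uncolours [qu], the next edge of the path. *)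
have [u] := minimal_shift mf eqp fqp pa ta; cbv zeta.
set g := recolour _ _ _ _ => -[[fqu up mg ua tua] [degq missq]].
have qu_uniq v : f q v = a -> v = u.
  by move=> fqv; apply: (finj q); rewrite fqv ?fqu // -lt0n.
have equ : e q u by apply: fe; rewrite fqu -lt0n.
have uq : u != q by rewrite eq_sym edge_neq.
case: (closedX q u qX (or_introl fqu)) => [uX|ur]; last first.
  exists [set q]; split.
  - by rewrite sub1set.
  - by rewrite set11.
  - move=> v w /set1P-> [/qu_uniq->|fqw]; first by right.
    by have := nqb w; rewrite fqw eqxx.
  - by move=> v /set1P->; rewrite eqxx.
  - by exists q; [exact: set11 | left; rewrite -ur].
have gE v w : v != q -> v != p -> v != u -> g v w = f v w.
  by move=> vq vp vu; rewrite /g !recolour_off.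
have gqu : g q u = 0.
  by rewrite /g recolour_row ?edge_neq // (negPf up) recolour_row ?eqxx // edge_neq.
have gu v : v != q -> g u v = f u v.
  by move=> vq; rewrite /g recolour_off // recolourC recolour_row // (negPf vq).
have tgb : tight g q b by move=> c cb; rewrite degq; exact: tb.
have memp v : v \in X -> v != p by apply: contraTneq => ->.
have [[gC _ _ _ _] _] := mg.
have gf v w : v \in X :\ q -> g v w = a \/ g v w = b -> f v w = g v w /\ w != q.
  rewrite !inE => /andP[vq vX] gvw.
  have [vu|vu] := eqVneq v u; last first.
    rewrite -gE ?memp //; split=> //; apply/eqP => wq; case: gvw; rewrite wq.
      by rewrite gE ?memp // fC => /qu_uniq/eqP; rewrite (negPf vu).
    by rewrite gE ?memp // fC => fqv; have := nqb v; rewrite fqv eqxx.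
  have wq : w != q.
    apply/eqP => wq; move: gvw; rewrite vu wq gC gqu => -[] eb.
      by rewrite -eb in a0.
    by rewrite -eb in b0.
  by rewrite vu gu.
have gab v w : g v w = b \/ g v w = a -> g v w = a \/ g v w = b by case; auto.
have card_X' : #|X :\ q| < n by move: ltXn; rewrite (cardsD1 q X) qX.
have uX' : u \in X :\ q by rewrite !inE uq.
have qX' : q \notin X :\ q by rewrite setD11.
have rX' : r \notin X :\ q by rewrite !inE negb_and rX orbT.
have ba : b != a by rewrite eq_sym.
have closedX' v w : v \in X :\ q -> g v w = b \/ g v w = a ->
    w \in X :\ q \/ w = r.
  move=> vX' /gab gvw; have [fvw wq] := gf _ _ vX' gvw.
  rewrite -fvw in gvw; move: vX'; rewrite !inE wq => /andP[_ vX].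
  exact: closedX gvw.
(* The colours exchange roles. By [gf], no edge coloured [a] or [b] in [g] leads from [X :\ q] back
   to [q], so [r] stays the only exit. *)
have [Y [YX' uY closedY bothY [v0 v0Y gv0]]] := IH g q u b a (X :\ q) card_X' mg
  equ gqu (missq _ qb) tgb ua tua uX' qX' rX' ba closedX'.
have YX v : v \in Y -> v \in X :\ q by move/(subsetP YX').
have gba v w : g v w = a \/ g v w = b -> g v w = b \/ g v w = a by case; auto.
exists (q |: Y); split.
- apply/subsetP => v /setU1P[->|/YX] //.
  by rewrite !inE => /andP[].
- exact: setU11.
- move=> v w /setU1P[->|vY] fvw.
    case: fvw => [/qu_uniq->|fqw]; first by left; rewrite setU1r.
    by have := nqb w; rewrite fqw eqxx.
  have [->|wq] := eqVneq w q; first by left; rewrite setU11.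
  have gvw : g v w = f v w.
    have [vu|vu] := eqVneq v u; first by rewrite vu gu.
    have := YX _ vY; rewrite !inE => /andP[vq vX].
    by rewrite gE // memp.
  rewrite -gvw in fvw.
  by case: (closedY _ _ vY (gba _ _ fvw)) => [wY|]; [left; rewrite setU1r | right].
- move=> v /setU1P[->|vY vq]; first by rewrite eqxx.
  have [->|vu] := eqVneq v u.
    split; first by exists q; rewrite fC.
    (* The [b] edge at [u] comes from a second shift, in [g] with hub [u]. *)
    have euq : e u q by rewrite e_sym.
    have guq : g u q = 0 by rewrite gC.
    have [x [[gux xq _ _ _] _]] := minimal_shift mg euq guq (missq _ qb) tgb.
    by exists x; rewrite -gu.
  have [[w gvw] [x gvx]] := bothY v vY vu.
  split; [exists x | exists w].
    by have [-> _] := gf v x (YX _ vY) (or_introl gvx).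
  by have [-> _] := gf v w (YX _ vY) (or_intror gvw).
- exists v0; first by rewrite setU1r.
  have gv0' := gab _ _ gv0.
  by have [-> _] := gf _ _ (YX _ v0Y) gv0'.
Qed.

(* Two states of the same fan at z: in f the edge zy is uncoloured and in g it
   has the colour b that y missed.  The alternating path from y avoids x in f,
   so in g the path from z, which starts with y, cannot reach x. *)
Lemma no_repetition f g z y x a b : minimal f -> minimal g ->
    (forall u v, u != z -> v != z -> f u v = g u v) ->
    e z y -> f z y = 0 -> g z y = b -> e z x -> g z x = 0 ->
    misses f z a -> tight f z a -> misses g z a -> tight g z a ->
    misses f y b -> tight f y b -> misses g x b -> tight g x b ->
    (forall v, f x v != b) -> x != y -> False.
Proof.
move=> mf mg fg ezy fzy gzy ezx gzx fza tfa gza tga fyb tfb gxb tgb nfxb xy.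
have zy := edge_neq ezy; have zx := edge_neq ezx.
have [b0 _ _] := fyb; have [_ _ ngza] := gza.
have [[gC _ _ ginj _] _] := mg.
have ab : a != b by rewrite eq_sym -gzy ngza.
have ba : b != a by rewrite eq_sym.
have yX : y \in ~: [set z] by rewrite !inE eq_sym.
have zX : z \notin ~: [set z] by rewrite !inE eqxx.
have closedX v u : v \in ~: [set z] -> f v u = a \/ f v u = b ->
    u \in ~: [set z] \/ u = z.
  by move=> _ _; have [->|uz] := eqVneq u z; [right | left; rewrite !inE uz].
have [Y [YX yY closedY bothY _]] :=
  alternating_path mf ezy fzy fza tfa fyb tfb yX zX zX ab closedX.
have xY : x \notin Y.
  apply/negP => xY; have [_ [u fxu]] := bothY x xY xy.
  by have := nfxb u; rewrite fxu eqxx.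
have Yz v : v \in Y -> v != z by move/(subsetP YX); rewrite !inE.
have zZ : z \in z |: Y by rewrite setU11.
have xZ : x \notin z |: Y by rewrite !inE eq_sym negb_or zx.
(* In [g], [z] misses [a] and its [b] edge leads to [y], so adding [z] to [Y] removes the exit. *)
have closedZ v u : v \in z |: Y -> g v u = b \/ g v u = a -> u \in z |: Y.
  move=> /setU1P[-> [gzu|gzu]|vY gvu].
  - have -> : u = y by apply: (ginj z); rewrite gzu // -lt0n.
    by rewrite setU1r.
  - by have := ngza u; rewrite gzu eqxx.
  have [->|uz] := eqVneq u z; first by rewrite setU11.
  have fvu : f v u = a \/ f v u = b by rewrite (fg _ _ (Yz _ vY) uz); case: gvu; auto.
  case: (closedY v u vY fvu) => [uY|uz']; first by rewrite setU1r.
  by rewrite uz' eqxx in uz.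
have exz : e x z by rewrite e_sym.
have gxz : g x z = 0 by rewrite gC.
(* The path from [z] in [g] would have to reach [x], outside the closed set [z |: Y]. *)
have [Z [ZY _ _ _ [v vZ gvx]]] := alternating_path mg exz gxz gxb tgb gza tga
  zZ xZ xZ ba (fun v u vZ gvu => or_introl (closedZ v u vZ gvu)).
by have := closedZ v x (subsetP ZY v vZ) gvx; rewrite (negPf xZ).
Qed.

(** * Full vertices and fans *)

Definition full f v := forall b, 0 < b -> b <= k -> exists u, f v u = b.

(** Each colour present adds an edge not counted at the previous threshold. *)
Lemma low_degree_present f v c : partial_colouring f ->
    (forall b, 0 < b -> b <= c -> exists u, f v u = b) ->
  low_degree f v 0 + c <= low_degree f v c.
Proof.
move=> [_ fe _ _ _]; elim: c => [|c IHc] present; first by rewrite addn0.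
have {}IHc := IHc (fun b b0 bc => present b b0 (leqW bc)).
have [u fvu] := present c.+1 isT (leqnn _).
have evu : e v u by apply: fe; rewrite fvu.
rewrite addnS; apply: leq_ltn_trans IHc _.
rewrite /low_degree (bigD1 u) //= [X in _ < X](bigD1 u) //= fvu ltnn leqnn.
by rewrite add0n add1n ltnS; apply: leq_sum => x _; have [/leqW->|] := leqP (f v x) c.
Qed.

(** The smallest missing colour is tight because all colours below it are present. *)
Lemma full_or_misses f v : partial_colouring f ->
  full f v \/ exists2 b, misses f v b & tight f v b.
Proof.
move=> pf.
have [/existsP ex|none] :=
    boolP [exists b : 'I_k.+1, (0 < b) && [forall u, f v u != b]].
  right; have [b0 b0P] := ex.
  have exb : exists b, [&& 0 < b, b <= k & [forall u, f v u != b]].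
    by exists b0; have [-> ->] := andP b0P; rewrite -ltnS ltn_ord.
  have [b /and3P[b_gt0 bk /forallP vb] minb] := ex_minnP exb.
  exists b; first by split.
  move=> c cb; apply: leq_trans (low_degree_present pf _); first exact: leq_addl.
  move=> d d0 dc; have [/existsP[u /eqP<-]|nd] := boolP [exists u, f v u == d].
    by exists u.
  have := minb d; rewrite d0 -negb_exists nd (leq_trans dc) ?(leq_trans (ltnW cb)) //.
  by move=> /(_ isT); lia.
left=> b b0 bk; have [/existsP[u /eqP<-]|nb] := boolP [exists u, f v u == b].
  by exists u.
case/existsP: none; exists (Ordinal (ltn_ord (inord b : 'I_k.+1))) => /=.
by rewrite inordK // b0 -negb_exists.
Qed.

Lemma full_degree f v : partial_colouring f -> full f v -> #|e v| = k.
Proof.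
move=> pf fv; apply/eqP; rewrite eqn_leq e_deg /=.
apply: leq_trans (low_degree_le f v k).
exact: leq_trans (leq_addl _ _) (low_degree_present pf fv).
Qed.

Lemma uncoloured_not_full f v u : partial_colouring f -> e v u -> f v u = 0 ->
  ~ full f v.
Proof.
move=> pf evu fvu fv; have := low_degree_present pf fv.
rewrite leqNgt => /negP; apply; apply: leq_ltn_trans (low_degree_le f v k) _.
apply: leq_ltn_trans (e_deg v) _.
by rewrite -[X in X < _]add0n ltn_add2r /low_degree (bigD1 u) //= fvu.
Qed.

(* S is the set of fan vertices already passed; each of them keeps the state h
   in which its edge to z was uncoloured. *)
Lemma fan_step f z a S y g : minimal f -> minimal g -> e z y -> g z y = 0 ->
    y \notin S ->
    (forall u v, u != z -> v != z -> g u v = f u v) ->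
    (forall v, v \notin S -> v != y -> g z v = f z v) ->
    misses g z a -> tight g z a ->
    (forall s, s \in S -> exists h,
       [/\ minimal h, e z s & h z s = 0] /\
       [/\ forall u v, u != z -> v != z -> h u v = f u v,
           forall v, v \notin S -> h z v = f z v,
           misses h z a & tight h z a] /\
       misses h s (g z s) /\ tight h s (g z s)) ->
  exists x h, [/\ minimal h, e z x, h z x = 0 & full f x].
Proof.
have [n] := ubnP #|~: S|; elim: n => // n IH in S y g *.
move=> ltSn mf mg ezy gzy yS gf gfz gza tga hist.
have [[fC fe _ _ _] _] := mf; have [[gC _ _ _ _] _] := mg.
have zy := edge_neq ezy; have yz : y != z by rewrite eq_sym.
(* Missing colours are read off in the initial [f], with which all states agree away from [z]. *)
have [fy|[b fyb tfb]] := full_or_misses y mf.1; first by exists y, g.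
have [b0 bk nfyb] := fyb.
have gyb : misses g y b.
  split=> // v; have [->|vz] := eqVneq v z; last by rewrite gf.
  by rewrite gC gzy eq_sym -lt0n.
have tgb : tight g y b.
  (* The edge [yz], uncoloured in [g], counts at every threshold. *)
  move=> c cb; apply: leq_trans (tfb c cb) _; apply: leq_sum => v _.
  by have [->|vz] := eqVneq v z; [rewrite gC gzy leq0n leq_b1 | rewrite gf].
have [x] := minimal_shift mg ezy gzy gyb tgb; cbv zeta.
set g' := recolour _ _ _ _ => -[[gzx xy mg' g'x tg'x] [degz missz]].
have yx : y != x by rewrite eq_sym.
have [[_ ge _ _ _] _] := mg.
have ezx : e z x by apply: ge; rewrite gzx -lt0n.
have zx := edge_neq ezx.
have [xS|xS] := boolP (x \in S).
  (* A repeated colour: [x] missed [b] in its recorded state [h], and [y] misses [b] in [g]. *)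
  have [h [[mh _ hzx] [[hf hfz hza tha] [hxb thb]]]] := hist x xS.
  have [[hC _ _ _ _] _] := mh.
  rewrite gzx in hxb thb.
  have hg u v : u != z -> v != z -> h u v = g u v by move=> uz vz; rewrite hf ?gf.
  have nhyb v : h y v != b.
    have [->|vz] := eqVneq v z; last by rewrite hf.
    by rewrite hC hfz // fC.
  by case: (no_repetition mh mg hg ezx hzx gzx ezy gzy hza tha gza tga hxb thb
    gyb tgb nhyb yx).
have g'z v : g' z v = if v == y then b else if v == x then 0 else g z v.
  by rewrite /g' !recolour_row.
have cardS : #|~: (y |: S)| < n.
  by rewrite setCU setIC -setDE; move: ltSn; rewrite (cardsD1 y (~: S)) !inE yS.
have g'x0 : g' z x = 0 by rewrite g'z (negPf xy) eqxx.
have xS' : x \notin y |: S by rewrite !inE negb_or xy.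
have g'f u v : u != z -> v != z -> g' u v = f u v.
  move=> uz vz; rewrite /g' /recolour (negPf uz) (negPf vz) !andbF /=.
  exact: gf.
apply: (IH (y |: S) x g') => //.
- move=> v; rewrite !inE negb_or => /andP[vy vS] vx.
  by rewrite g'z (negPf vy) (negPf vx) gfz.
- exact: missz.
- by move=> c ca; rewrite degz; exact: tga.
move=> s /setU1P[->|sS].
  (* The state recorded for [y] is [g] itself. *)
  exists g; rewrite g'z eqxx; split=> //; split=> //; split=> //.
  by move=> v; rewrite !inE negb_or => /andP[vy vS]; exact: gfz.
have [h [mh [[hf hfz hza tha] hs]]] := hist s sS.
have sy : s != y by apply: contraNneq yS => <-.
have sx : s != x by apply: contraNneq xS => <-.
exists h; rewrite g'z (negPf sy) (negPf sx); split=> //; split=> //; split=> //.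
by move=> v; rewrite !inE negb_or => /andP[_ vS]; exact: hfz.
Qed.

(** The last fan vertex is full in [f] itself, where [w] has an uncoloured edge; so they differ. *)
Lemma fan f z w : minimal f -> e z w -> f z w = 0 ->
  exists y h, [/\ minimal h, e z y, h z y = 0, y != w & #|e y| = k].
Proof.
move=> mf ezw fzw; have [pf _] := mf; have [fC _ _ _ _] := pf.
have [fz|[a fza tfa]] := full_or_misses z pf.
  by case: (uncoloured_not_full pf ezw fzw).
have w0 : w \notin set0 by rewrite inE.
have hist s : s \in set0 -> exists h,
    [/\ minimal h, e z s & h z s = 0] /\
    [/\ forall u v, u != z -> v != z -> h u v = f u v,
        forall v, v \notin set0 -> h z v = f z v,
        misses h z a & tight h z a] /\
    misses h s (f z s) /\ tight h s (f z s) by rewrite inE.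
have [y [h [mh ezy hzy fy]]] := fan_step mf mf ezw fzw w0
  (fun _ _ _ _ => erefl) (fun _ _ _ => erefl) fza tfa hist.
exists y, h; split=> //; last exact: full_degree fy.
apply/eqP => yw; move: fy; rewrite yw; apply: (@uncoloured_not_full _ _ z) => //.
  by rewrite e_sym.
by rewrite fC.
Qed.

(** * The walk among vertices of degree [k] *)

(** The list is the walk so far, read backwards from the hub [v]. A fan at [v] gives a vertex other
    than [u] that prolongs the path or closes a cycle; [n] bounds the steps left. *)
Lemma core_cycle_from n c u v : #|T| < n + size c ->
    uniq [:: v, u & c] -> path e v (u :: c) ->
    {subset [:: v, u & c] <= [pred x | #|e x| == k]} ->
    (exists f, minimal f /\ f v u = 0) ->
  exists d, graph_cycle e d /\ {subset d <= [pred x | #|e x| == k]}.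
Proof.
elim: n => [|n IH] in c u v *.
  rewrite add0n => ltTc uc; have := max_card (mem [:: v, u & c]).
  by rewrite (card_uniqP uc) => /leq_ltn_trans/(_ ltTc) /=; lia.
move=> ltTc uc pc core [f [mf fvu]].
have evu : e v u by case/andP: pc.
have [x [h [mh evx hvx xu xk]]] := fan mf evu fvu.
have exv : e x v by rewrite e_sym.
have xv : x != v by exact: edge_neq.
have [xc|xc] := boolP (x \in c); last first.
  apply: (IH (u :: c) v x) => //=; first by rewrite addnS.
  - by rewrite !inE (negPf xv) (negPf xu) (negPf xc).
  - by rewrite exv.
  - by move=> y; rewrite inE => /orP[/eqP->|/core//]; rewrite inE xk.
  - by exists h; split=> //; have [[hC _ _ _ _] _] := mh; rewrite hC.
case/splitPr: xc => c1 c2 in uc pc core *.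
(* Cutting at [x], which is not [u], leaves at least the three vertices [v], [u], [x]. *)
exists [:: v, u & rcons c1 x]; split; last first.
  move=> y yd; apply: core; move: yd; rewrite !inE mem_rcons mem_cat !inE.
  by case/or4P=> -> //; rewrite !orbT.
split; first by rewrite /= size_rcons.
rewrite /ucycle; apply/andP; split.
  move: pc; rewrite /= cat_path /= => /and4P[-> c1P c1x _].
  by rewrite !rcons_path last_rcons c1P c1x exv.
by move: uc; rewrite -cat_rcons -2!cat_cons cat_uniq => /andP[].
Qed.

Lemma exists_minimal : exists f, minimal f.
Proof.
suff descent n f : partial_colouring f -> potential f < n -> exists g, minimal g.
  by apply: (descent _ (fun _ _ => 0) _ (leqnn _)); split.
elim: n f => // n IH f pf ltfn.
have [[g [pg lt_gf]]|noless] :=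
  classic (exists g, partial_colouring g /\ potential g < potential f).
  by apply: (IH g) => //; exact: leq_trans lt_gf ltfn.
exists f; split=> // g pg; rewrite leqNgt; apply/negP => lt_gf.
by apply: noless; exists g.
Qed.

Lemma exists_total_colouring :
    (forall c, {subset c <= [pred x | #|e x| == k]} -> ~ graph_cycle e c) ->
  exists2 f, partial_colouring f & forall x y, e x y -> f x y != 0.
Proof.
move=> acyclic; have [f mf] := exists_minimal; have [pf _] := mf.
exists f => // x w exw; apply/negP => /eqP fxw.
(* Two successive fans yield an uncoloured edge with both ends of degree [k], where the walk
   starts. *)
have [y [g [mg exy gxy _ ky]]] := fan mf exw fxw.
have eyx : e y x by rewrite e_sym.
have gyx : g y x = 0 by have [[gC _ _ _ _] _] := mg; rewrite gC.
have [z [h [mh eyz hyz zx kz]]] := fan mg eyx gyx.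
have zy : z != y by rewrite eq_sym edge_neq.
have [|||||c [cycle_c core_c]] := @core_cycle_from #|T|.+1 [::] y z.
- by rewrite addn0.
- by rewrite /= inE zy.
- by rewrite /= e_sym eyz.
- by move=> v; rewrite !inE => /orP[]/eqP->; apply/eqP.
- by exists h; split=> //; have [[hC _ _ _ _] _] := mh; rewrite hC.
exact: acyclic core_c cycle_c.
Qed.

End LocalColouring.

(** * Passing to edges as two-element sets *)

Lemma mem_edges (T : finType) (e : rel T) (E : {set T}) :
  reflect (exists x y, e x y /\ E = [set x; y]) (E \in edges e).
Proof.
apply: (iffP imset2P) => [[x y _]|[x [y [exy ->]]]].
  by rewrite inE => exy ->; exists x, y.
by exists x y; rewrite ?inE.
Qed.

Lemma degreeE (T : finType) (e : rel T) (x : T) : simple_graph e ->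
  degree e x = #|e x|.
Proof.
case=> e_sym e_irr; rewrite -(card_in_imset (f := fun y => [set x; y])).
  apply: eq_card => E; rewrite inE; apply/andP/imsetP => [[]|[y exy ->]].
    move=> /mem_edges[u [v [euv ->]]] /set2P[xu|xv].
      by exists v; rewrite ?xu.
    by exists u; rewrite ?xv 1?setUC // -topredE /= e_sym.
  by rewrite set21; split=> //; apply/mem_edges; exists x, y; split.
move=> y z; rewrite !unfold_in => exy exz eyz.
have: y \in [set x; z] by rewrite -eyz set22.
by case/set2P => // yx; rewrite yx e_irr in exy.
Qed.

Lemma max_multiplicity_gt0 (T : finType) (e : rel T) (x y : T) :
  e x y -> 0 < max_multiplicity e x.
Proof.
move=> exy; apply: leq_trans (leq_bigmax_cond _ exy).
rewrite /multiplicity; apply/card_gt0P; exists [set x; y].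
by rewrite inE eqxx andbT; apply/mem_edges; exists x, y.
Qed.

Theorem theorem1p2 (T : finType) (e : rel T) (k : nat)
    (he : simple_graph e) (hk : 0 < k)
    (hdeg : forall x : T, degree e x <= k)
    (hcore : spans_no_cycle e [set x : T | degree e x == k]) :
  exists phi : {set T} -> nat,
    [/\ edge_colouring e k phi,
        proper_colouring e phi
      & local_colouring e phi].
Proof.
have [e_sym e_irr] := he.
have [] := @exists_total_colouring T e k e_sym e_irr.
- by move=> x; rewrite -degreeE.
- move=> c core; apply: hcore => x /core.
  by rewrite !inE degreeE.
move=> f [fC fe fk finj floc] ftotal.
(* On an edge the diagonal terms are 0 and the other two agree by symmetry. *)
pose phi (E : {set T}) := \max_(x in E) \max_(y in E) f x y.
have phiE x y : e x y -> phi [set x; y] = f x y.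
  have fxx z : f z z = 0 by apply/eqP/contraT => /fe; rewrite e_irr.
  move=> exy; have xy : x \notin [set y].
    by rewrite inE; apply/eqP => xy; rewrite xy e_irr in exy.
  rewrite /phi big_setU1 //= big_set1 !big_setU1 //= !big_set1 !fxx.
  by rewrite max0n maxn0 [f y x]fC maxnn.
exists phi; split.
- move=> E /mem_edges[x [y [exy ->]]].
  by rewrite phiE // lt0n ftotal // fk.
- move=> E F /mem_edges[x [y [exy ->]]] /mem_edges[u [v [euv ->]]] neq.
  case/set0Pn => z /setIP[zxy zuv].
  (* Writes each of the two edges from the common end [z], so that [finj] applies. *)
  have star (s t : T) : e s t -> z \in [set s; t] ->
      exists2 w, e z w & [set s; t] = [set z; w].
    move=> est /set2P[->|->]; first by exists t.
    by exists s; rewrite 1?e_sym // setUC.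
  have [w ezw xyE] := star _ _ exy zxy; have [t ezt uvE] := star _ _ euv zuv.
  rewrite xyE uvE !phiE //; apply: contraNneq neq => fzw.
  by rewrite xyE uvE (finj z w t (ftotal _ _ ezw) fzw).
- move=> x y exy; rewrite phiE //.
  have eyx : e y x by rewrite e_sym.
  have := max_multiplicity_gt0 exy; have := max_multiplicity_gt0 eyx.
  by have := floc x y; rewrite !degreeE //; lia.
Qed.
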